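(* Let $n=5$, $q\geq 3$, and $r\geq 1$ with $r\neq 3$. Then the $5$ prisoners have a winning strategy in the prisoners-and-rooms game with $r$ rooms and $q$ states, for any known initial configuration of room states.
   Context: The game: there are $n$ prisoners and $r$ rooms; each room contains a switch that is in one of $q$ states $\{0,1,\ldots,q-1\}$. The initial state of every room is known to the prisoners. A warden leads prisoners into rooms one at a time according to a schedule, i.e. an infinite sequence of (prisoner, room) pairs; a schedule is valid if every prisoner visits every room infinitely often. The rooms are indistinguishable to the prisoners, and prisoners have no information about time or other visits: on each visit a prisoner observes only the current state of the room, may change it to any state, and may declare that all prisoners have visited all rooms. A (deterministic) strategy assigns to each prisoner a rule determining, from the sequence of states that prisoner has observed so far (and their own previous actions), what new state to set and whether to declare. A strategy is winning if for every valid schedule some prisoner eventually declares, and every declaration is made only at a time when every prisoner has already visited every room. Strategies may differ between prisoners. *)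

(* Defs.v *)
From mathcomp Require Import all_boot.
Set Implicit Arguments. Unset Strict Implicit. Unset Printing Implicit Defensive.

Definition schedule (n r : nat) := nat -> 'I_n * 'I_r.

Definition valid_schedule (n r : nat) (s : schedule n r) : Prop :=
  forall (p : 'I_n) (rm : 'I_r) (N : nat), exists2 t, N <= t & s t = (p, rm).

(* A deterministic strategy: each prisoner p maps the sequence of states it
   has observed so far (oldest first, ending with the current observation)
   to (new state to set, whether to declare).  Since the prisoner's own
   previous actions are a deterministic function of its earlier
   observations, they need not be passed separately. *)
Definition strategy (n q : nat) := 'I_n -> seq 'I_q -> 'I_q * bool.

Definition gstate (n r q : nat) := (('I_r -> 'I_q) * ('I_n -> seq 'I_q))%type.

Definition step (n r q : nat) (st : strategy n q) (pr : 'I_n * 'I_r)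
  (g : gstate n r q) : gstate n r q :=
  let: (p, rm) := pr in
  let: (conf, hist) := g in
  let h' := rcons (hist p) (conf rm) in
  let ns := (st p h').1 in
  ((fun i => if i == rm then ns else conf i),
   (fun j => if j == p then h' else hist j)).

Fixpoint run (n r q : nat) (init : 'I_r -> 'I_q) (st : strategy n q)
  (s : schedule n r) (t : nat) : gstate n r q :=
  match t with
  | 0 => (init, fun _ => [::])
  | t'.+1 => step st (s t') (run init st s t')
  end.

Definition declares (n r q : nat) (init : 'I_r -> 'I_q) (st : strategy n q)
  (s : schedule n r) (t : nat) : bool :=
  let: (p, rm) := s t in
  let: (conf, hist) := run init st s t in
  (st p (rcons (hist p) (conf rm))).2.

(* Winning: for every valid schedule someone eventually declares, and every
   declaration happens only when every prisoner has visited every room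
   (the visit at the declaration time itself counts). *)
Definition winning (n r q : nat) (init : 'I_r -> 'I_q) (st : strategy n q) : Prop :=
  forall s : schedule n r, valid_schedule s ->
    (exists t, declares init st s t) /\
    (forall t, declares init st s t ->
       forall (p : 'I_n) (rm : 'I_r), exists2 t', t' <= t & s t' = (p, rm)).

(* Main.v *)
Require Import Defs.
From mathcomp Require Import all_boot.
From mathcomp Require Import zify.

(** A prisoner who knows the multiset of room states, while all others are inert,
    visits every room by turning all rooms from one state into another. So the
    point is to hand this control over. First the prisoners synchronise: one of them
    makes all rooms show s2 while the others convert s2 to s0, each with a quota
    too large to be used up before every other state has disappeared. A prisoner
    with an exhausted quota has then seen only s0 and s2 since, so the first s1
    tells the second prisoner that it is in control; s1 followed by s2 tells the
    third; and s1, s2, s0 in this order activates the last two. These two compete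
    for a single room in state s0: whoever takes it first sweeps the rooms and then
    leaves two rooms in state s0, so that the second one, after taking one of them,
    recognises the situation by finding the other. *)

Set Implicit Arguments. Unset Strict Implicit. Unset Printing Implicit Defensive.

(** * Counter automata as strategies *)

(* A prisoner is a deterministic automaton with a counter: [None] means that the
   room is left as it is and the counter does not move. *)
Definition machine (n q : nat) := 'I_n -> nat -> 'I_q -> option (nat * 'I_q * bool).

Definition upd (I : finType) (T : Type) (f : {ffun I -> T}) (i : I) (x : T)
    : {ffun I -> T} :=
  [ffun j => if j == i then x else f j].

Definition visit (n r : nat) (vis : {ffun 'I_n -> {set 'I_r}}) (p : 'I_n)
    (rm : 'I_r) : {ffun 'I_n -> {set 'I_r}} :=
  upd vis p (rm |: vis p).

Definition bounded_machine (n q : nat) (d : machine n q) (B : nat) : Prop :=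
  forall p k c k' w b, d p k c = Some (k', w, b) -> k < k' <= B.

Definition state_pred (n r q : nat) :=
  {ffun 'I_r -> 'I_q} -> {ffun 'I_n -> nat} -> {ffun 'I_n -> {set 'I_r}} -> Prop.

(** After a declaring move only completeness of the visits is demanded: visited sets never shrink,
    so a correct first declaration makes all later ones correct. *)
Definition step_ok (n r q : nat) (d : machine n q) (Inv : state_pred n r q)
    (g : {ffun 'I_r -> 'I_q}) (pc : {ffun 'I_n -> nat})
    (vis : {ffun 'I_n -> {set 'I_r}}) (p : 'I_n) (rm : 'I_r) : Prop :=
  match d p (pc p) (g rm) with
  | None => Inv g pc (visit vis p rm)
  | Some (k, w, b) =>
      if b then forall p' rm', rm' \in visit vis p rm p'
      else Inv (upd g rm w) (upd pc p k) (visit vis p rm)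
  end.

Definition live_invariant (n r q : nat) (d : machine n q)
    (Inv : state_pred n r q) : Prop :=
  forall g pc vis, Inv g pc vis ->
    (exists p rm, d p (pc p) (g rm)) /\ (forall p rm, step_ok d Inv g pc vis p rm).

Section MachineStrategy.

Variables (n r q : nat) (d : machine n q) (init : 'I_r -> 'I_q) (c0 : 'I_q).

Definition read_step (p : 'I_n) (acc : nat * ('I_q * bool)) (c : 'I_q) :=
  if d p acc.1 c is Some (k, w, b) then (k, (w, b)) else (acc.1, (c, false)).

(** [c0] only fills the output slot before the first observation; the game queries a strategy on
    histories containing one, which overwrites it. *)
Definition read (p : 'I_n) (h : seq 'I_q) :=
  foldl (read_step p) (0, (c0, false)) h.

Definition strategy_of : strategy n q := fun p h => (read p h).2.

Variable s : schedule n r.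

(** Finite functions make equality of configurations extensional, so that a period without moves can
    be expressed by an equation. *)
Fixpoint conf (t : nat) : {ffun 'I_r -> 'I_q} * {ffun 'I_n -> nat} :=
  if t is t'.+1 then
    let: (p, rm) := s t' in let: (g, pc) := conf t' in
    if d p (pc p) (g rm) is Some (k, w, _) then (upd g rm w, upd pc p k)
    else (g, pc)
  else (finfun init, [ffun => 0]).

Fixpoint visited (t : nat) : {ffun 'I_n -> {set 'I_r}} :=
  if t is t'.+1 then visit (visited t') (s t').1 (s t').2 else [ffun => set0].

Lemma run_conf t :
  (forall i, (run init strategy_of s t).1 i = (conf t).1 i) /\
  (forall p, (read p ((run init strategy_of s t).2 p)).1 = (conf t).2 p).
Proof.
elim: t => [|t [IHg IHh]] /=; first by split=> i; rewrite !ffunE.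
case Es: (s t) => [p rm].
case: (run _ _ _ t) IHg IHh => g h /= IHg IHh.
case: (conf t) IHg IHh => g' pc /= IHg IHh.
rewrite /strategy_of /read foldl_rcons -/(read p (h p)) /read_step IHh IHg.
case E: (d p (pc p) (g' rm)) => [[[k w] b]|] /=; split=> i; rewrite ?ffunE.
- by case: eqP => _.
- case: eqP => [->|_]; last exact: IHh.
  by rewrite foldl_rcons -/(read p (h p)) /read_step IHh E.
- by case: (i =P rm) => [->|_].
- case: eqP => [->|_]; last exact: IHh.
  by rewrite foldl_rcons -/(read p (h p)) /read_step IHh E.
Qed.

Lemma declares_conf t :
  declares init strategy_of s t =
  if d (s t).1 ((conf t).2 (s t).1) ((conf t).1 (s t).2) is Some (_, _, b)
  then b else false.
Proof.
rewrite /declares; case Es: (s t) => [p rm] /=.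
have [Hg Hh] := run_conf t.
case: (run _ _ _ t) Hg Hh => g h /= Hg Hh.
rewrite /strategy_of /read foldl_rcons -/(read p (h p)) /read_step Hh Hg.
by case: (d _ _ _) => [[[k w] b]|].
Qed.

Lemma visitedP t p rm :
  reflect (exists2 t', t' < t & s t' = (p, rm)) (rm \in visited t p).
Proof.
elim: t => [|t IH] /=; first by rewrite ffunE inE; constructor; case.
have -> : (rm \in visit (visited t) (s t).1 (s t).2 p) =
          (s t == (p, rm)) || (rm \in visited t p).
  rewrite /visit ffunE; case: (s t) => p' rm' /=; rewrite xpair_eqE eq_sym.
  by case: eqP => [->|_] //=; rewrite in_setU1 eq_sym.
apply: (iffP orP) => [[/eqP E|/IH [t' lt_t' E]]|[t']].
- by exists t.
- by exists t' => //; apply: ltnW.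
rewrite ltnS leq_eqVlt => /predU1P [->|lt_t'] E; first by left; apply/eqP.
by right; apply/IH; exists t'.
Qed.

End MachineStrategy.

(* Counters only increase and are bounded, so an enabled visit, which stays
   enabled until somebody moves, is all that liveness needs. *)
Theorem machine_winning (n r q : nat) (d : machine n q) (init : 'I_r -> 'I_q)
    (c0 : 'I_q) (B : nat)
    (Inv : state_pred n r q) :
  bounded_machine d B -> live_invariant d Inv ->
  Inv (finfun init) [ffun => 0] [ffun => set0] ->
  winning init (strategy_of d c0).
Proof.
move=> dB invI Inv0 s valid_s.
have live g pc vis (I : Inv g pc vis) := (invI g pc vis I).1.
have step g pc vis (I : Inv g pc vis) := (invI g pc vis I).2.
set decl := declares init _ s.
pose I t := Inv (conf d init s t).1 (conf d init s t).2 (visited s t).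
pose total t := \sum_p (conf d init s t).2 p.
have I_all t : (forall t', t' < t -> ~~ decl t') -> I t.
  elim: t => [|t IH] no_decl; first exact: Inv0.
  have {}IH : I t by apply: IH => t' lt_t'; apply: no_decl; apply: ltnW.
  have := no_decl t (ltnSn t); rewrite /decl declares_conf /I /=.
  have := step _ _ _ IH (s t).1 (s t).2; rewrite /step_ok.
  case: (s t) => p rm /=; case: (conf _ _ _ t) => g pc /=.
  by case: (d p _ _) => [[[k w] []]|].
have first_decl t : decl t -> exists2 m, m <= t & decl m /\ I m.
  move=> decl_t; have ex : exists m, decl m by exists t.
  case: (ex_minnP ex) => m decl_m min_m; exists m; first exact: min_m.
  split=> //; apply: I_all => t' lt_t'; apply/negP => /min_m.
  by rewrite leqNgt lt_t'.
have total_le t : total t <= n * B.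
  rewrite -[n in n * B](card_ord n) -sum_nat_const; apply: leq_sum => p _.
  elim: t => [|t IH] /=; first by rewrite ffunE.
  case: (s t) => p' rm; case: (conf _ _ _ t) IH => g pc /= IH.
  case E: (d _ _ _) => [[[k w] b]|] //=; rewrite ffunE.
  by case: eqP => // _; case/andP: (dB _ _ _ _ _ _ E).
have totalS t : total t < total t.+1 \/ conf d init s t.+1 = conf d init s t.
  rewrite /total /=; case: (s t) => p rm; case: (conf _ _ _ t) => g pc /=.
  case E: (d p _ _) => [[[k w] b]|] //=; last by right.
  left; rewrite (bigD1 p) //= [X in _ < X](bigD1 p) //= ffunE eqxx.
  case/andP: (dB _ _ _ _ _ _ E) => lt_k _.
  rewrite -addSn; apply: leq_add => //; apply: leq_sum => i /negbTE neq_i.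
  by rewrite ffunE neq_i.
have total_mono t t' : t <= t' ->
    total t < total t' \/ conf d init s t' = conf d init s t.
  move/subnKC <-; elim: (t' - t) => [|m IH]; first by rewrite addn0; right.
  rewrite addnS; case: (totalS (t + m)) IH => [lt1|E] [lt2|E2].
  - by left; apply: ltn_trans lt1.
  - by left; rewrite /total -E2.
  - by left; rewrite /total E.
  - by right; rewrite E.
split; last first.
  move=> t /first_decl [m le_m [decl_m Im]] p rm.
  have := step _ _ _ Im (s m).1 (s m).2; move: decl_m.
  rewrite /decl declares_conf /step_ok.
  case: (d _ _ _) => [[[k w] []]|] // _ /(_ p rm) vis_p.
  (* Time [m.+1] rather than [m], since the declaring visit itself counts. *)
  have /visitedP [t' lt_t' E] : rm \in visited s m.+1 p by [].
  by exists t' => //; apply: leq_trans le_m.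
(* Induction on the remaining budget [n * B - total t]. Validity brings the visit enabled at [t] at
   some later time [t']; either a counter has moved before, or the configuration is still the same
   and this visit moves one. *)
have ex_decl k t : n * B - total t < k -> exists t, decl t.
  elim: k t => [|k IH] t //; rewrite ltnS => le_k.
  case: (boolP [exists t' : 'I_t, decl t']) => [/existsP [t' ?]|no_decl].
    by exists t'.
  have It : I t.
    apply: I_all => t' lt_t'; apply/negP => decl_t'.
    by case/existsP: no_decl; exists (Ordinal lt_t').
  case: (live _ _ _ It) => p [rm dp].
  case: (valid_s p rm t) => t' le_t' E.
  have lt_total : total t < total t'.+1.
    case: (total_mono _ _ le_t') => [lt1|Ec].
      by case: (total_mono _ _ (leqnSn t')) => [|E2]; [lia|rewrite /total E2].
    have Et : total t' = total t by rewrite /total Ec.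
    case: (totalS t') => [|]; first by rewrite Et.
    rewrite /= E Ec; case: (conf d init s t) dp => g pc /=.
    case Ed: (d _ _ _) => [[[k' w] b]|] //= _ [_ /ffunP/(_ p)].
    by rewrite ffunE eqxx; case/andP: (dB _ _ _ _ _ _ Ed) => + _ E'; rewrite E' ltnn.
  by apply: (IH t'.+1); have := total_le t'.+1; lia.
exact: (ex_decl _ 0 (ltnSn _)).
Qed.

(** * Counting rooms by state *)

Section Counting.

Variables r q : nat.
Implicit Types (g : {ffun 'I_r -> 'I_q}) (P : pred 'I_q).

Definition cnt g P : nat := \sum_i P (g i).

(** Additive form, because natural subtraction truncates; linear arithmetic can use it directly. *)
Lemma cnt_upd g rm w P : cnt (upd g rm w) P + P (g rm) = cnt g P + P w.
Proof.
rewrite /cnt (bigD1 rm) //= [in RHS](bigD1 rm) //= ffunE eqxx.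
have -> : \sum_(i | i != rm) P (upd g rm w i) = \sum_(i | i != rm) P (g i).
  by apply: eq_bigr => i /negbTE neq_i; rewrite ffunE neq_i.
by rewrite [RHS]addnAC addnC addnA.
Qed.

Definition num g (c : 'I_q) : nat := cnt g (pred1 c).

Lemma num_upd g rm w c :
  num (upd g rm w) c + (g rm == c) = num g c + (w == c).
Proof. exact: cnt_upd. Qed.

Lemma cnt_gt0 g P rm : P (g rm) -> 0 < cnt g P.
Proof. by move=> Prm; rewrite /cnt (bigD1 rm) //= Prm. Qed.

Lemma cntP g P : 0 < cnt g P -> exists rm, P (g rm).
Proof.
case: (boolP [exists rm, P (g rm)]) => [/existsP //|/existsPn noP].
by rewrite /cnt big1 // => i _; rewrite (negbTE (noP i)).
Qed.

Lemma cnt0 g P : cnt g P = 0 -> forall rm, P (g rm) = false.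
Proof. by move=> c0 rm; apply/negP => /cnt_gt0; rewrite c0. Qed.

Lemma cnt_predC g P : cnt g P + cnt g (predC P) = r.
Proof.
rewrite /cnt -big_split /= -[RHS]card_ord -sum1_card.
by apply: eq_bigr => i _; case: (P _).
Qed.

Lemma cnt_full g P : cnt g P = r -> forall rm, P (g rm).
Proof.
move=> full rm; have := cnt_predC g P; rewrite full => E.
have /cnt0/(_ rm) /= : cnt g (predC P) = 0 by lia.
by case: (P _).
Qed.

Lemma cnt1 g P rm : cnt g P = 1 -> P (g rm) -> forall i, i != rm -> ~~ P (g i).
Proof.
move=> c1 Prm i neq_i; apply/negP => Pi; move: c1.
by rewrite /cnt (bigD1 rm) //= (bigD1 i) //= Prm Pi.
Qed.

End Counting.

(** * Synchronisation: all rooms to s2 *)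

Section Synchronisation.

Variables (n r q : nat) (s0 s2 : 'I_q) (tail : machine n.+2 q).
Variable init : 'I_r -> 'I_q.

Implicit Types (g : {ffun 'I_r -> 'I_q}) (pc : {ffun 'I_n.+2 -> nat}).
Implicit Types (vis : {ffun 'I_n.+2 -> {set 'I_r}}) (InvT : state_pred n.+2 r q).

(** The signal state s1 of the later phases is a stray too, so its first appearance after
    synchronisation carries information. *)
Let stray : pred 'I_q := fun c => (c != s0) && (c != s2).
Let g0 : {ffun 'I_r -> 'I_q} := finfun init.
Let strays := cnt g0 stray.
(** Every s0 that ever has to be converted: the initial ones, one per stray, and [r.+1] from each of
    the [n.+1] clients. *)
Let swaps := num g0 s0 + strays + n.+1 * r.+1.

Definition clients pc : nat := \sum_(p | p != ord0) pc p.

(* Prisoner [ord0] turns the stray symbols into s0 and then every s0 into s2;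
   each client turns s2 into s0 exactly r.+1 times. Once [ord0] has made
   [strays + swaps] moves all rooms show s2 and all quotas are exhausted. *)
Definition sync_end (p : 'I_n.+2) : nat :=
  if p == ord0 then strays + swaps else r.+1.

(** A prisoner with exhausted quota enters [tail] without waiting for the others; a client that does
    so early is kept still by [tail_idle]. *)
Definition sync_machine : machine n.+2 q := fun p k c =>
  if k < sync_end p then
    if p == ord0 then
      if k < strays then (if stray c then Some (k.+1, s0, false) else None)
      else (if c == s0 then Some (k.+1, s2, false) else None)
    else (if c == s2 then Some (k.+1, s0, false) else None)
  else if tail p (k - sync_end p) c is Some (k', w, b)
    then Some (sync_end p + k', w, b) else None.

(* A client empties at most [num g0 s2 <= r] rooms before the last
   stray symbol is gone, so its quota of r.+1 is exhausted only afterwards. *)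
Definition syncing : state_pred n.+2 r q := fun g pc vis =>
  [/\ pc ord0 < sync_end ord0, forall p, pc p <= sync_end p,
      cnt g stray + minn (pc ord0) strays = strays,
      num g s2 + clients pc =
        num g0 s2 + (pc ord0 - strays)
    & forall p, 0 < pc p -> vis p != set0].

Definition synced (InvT : state_pred n.+2 r q) : state_pred n.+2 r q :=
  fun g pc vis => exists rel : {ffun 'I_n.+2 -> nat},
    pc = [ffun p => sync_end p + rel p] /\ InvT g rel vis.

Hypotheses (r_gt0 : 0 < r) (s02 : s0 != s2).
Hypothesis tail_idle :
  forall p, p != ord0 -> tail p 0 s0 = None /\ tail p 0 s2 = None.

Lemma cnt_split g : num g s0 + num g s2 + cnt g stray = r.
Proof.
rewrite -addnA; apply: etrans (cnt_predC g (pred1 s0)); congr (_ + _).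
rewrite /num /cnt -big_split; apply: eq_bigr => i _ /=; rewrite /stray.
by case: (eqVneq (g i) s0) => [->|_] /=; [rewrite (negbTE s02)|case: (_ == _)].
Qed.

Lemma sum_clients  pc :
  (forall p, pc p <= sync_end p) -> clients pc <= n.+1 * r.+1.
Proof.
move=> le_pc; apply: (@leq_trans (\sum_(p : 'I_n.+2 | p != ord0) r.+1)).
  by apply: leq_sum => p /negbTE p0; have := le_pc p; rewrite /sync_end p0.
by rewrite sum_nat_const cardC1 card_ord.
Qed.

Lemma synced_live InvT :
  live_invariant tail InvT -> live_invariant sync_machine (synced InvT).
Proof.
move=> invT g pc vis [rel [-> I]]; have [[p [rm dp]] step] := invT _ _ _ I.
have E p' c : sync_machine p' (sync_end p' + rel p') c =
    if tail p' (rel p') c is Some (k', w, b)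
    then Some (sync_end p' + k', w, b) else None.
  by rewrite /sync_machine ltnNge leq_addr /= addKn.
split; first by exists p, rm; rewrite ffunE E; move: dp; case: (tail _ _ _) => [[[]]|].
move=> p' rm'; have := step p' rm'; rewrite /step_ok ffunE E.
case: (tail _ _ _) => [[[k w] []]|] // I'.
  exists (upd rel p' k); split=> //; apply/ffunP => i; rewrite !ffunE.
  by case: eqP => [->|].
by exists rel.
Qed.

(** At the end the balance reads [num g s2 + clients pc = r + n.+1 * r.+1]. Both summands on the
    left are then at their maximum, so every room shows s2 and every quota is used up. As all quotas
    are positive, everybody has visited some room. *)
Lemma sync_finished InvT g pc vis :
  (forall vis, (forall p, vis p != set0) -> InvT [ffun => s2] [ffun => 0] vis) ->
  pc ord0 = sync_end ord0 -> (forall p, pc p <= sync_end p) ->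
  cnt g stray + minn (pc ord0) strays = strays ->
  num g s2 + clients pc =
        num g0 s2 + (pc ord0 - strays) ->
  (forall p, 0 < pc p -> vis p != set0) -> synced InvT g pc vis.
Proof.
move=> init_inv pc0 le_pc _ E vis_pc; have := sum_clients le_pc.
have := cnt_split g; have := cnt_split g0; move: (pc0) E.
have end0 : sync_end ord0 = strays + swaps by [].
rewrite end0 /swaps => -> E sp0 sp le_sum.
have full : num g s2 = r by lia.
have sumE : clients pc = n.+1 * r.+1 by lia.
have pcE (p : 'I_n.+2) : pc p = sync_end p.
  case: (eqVneq p ord0) => [->//|p0].
  apply/eqP; rewrite eqn_leq le_pc /=; move: sumE.
  have -> : n.+1 * r.+1 = \sum_(p : 'I_n.+2 | p != ord0) sync_end p.
    rewrite (eq_bigr (fun => r.+1)); last by move=> i /negbTE i0; rewrite /sync_end i0.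
    by rewrite sum_nat_const cardC1 card_ord.
  rewrite /clients (bigD1 p) //= [in RHS](bigD1 p) //=.
  have le_rest : \sum_(i | (i != ord0) && (i != p)) pc i
      <= \sum_(i | (i != ord0) && (i != p)) sync_end i by apply: leq_sum.
  by move=> eq_sum; have := leq_add (leqnn (pc p)) le_rest; rewrite eq_sum leq_add2r.
exists [ffun => 0]; split.
  by apply/ffunP => p; rewrite !ffunE addn0.
have -> : g = [ffun => s2].
  by apply/ffunP => i; rewrite ffunE; apply/eqP/(cnt_full full).
apply: init_inv => p; apply: vis_pc; rewrite pcE /sync_end.
by case: eqP => // _; rewrite /swaps mulSn; lia.
Qed.

Lemma visit_gt0 pc vis p rm :
  (forall p, 0 < pc p -> vis p != set0) ->
  forall p' : 'I_n.+2, (p' = p \/ 0 < pc p') -> visit vis p rm p' != set0.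
Proof.
move=> vis_pc p' pos; rewrite /visit ffunE.
case: (p' =P p) pos => [_ _|neq [//|/vis_pc //]].
by apply/set0Pn; exists rm; rewrite setU11.
Qed.

Lemma sum_upd pc p k : p != ord0 ->
  clients (upd pc p k) + pc p = clients pc + k.
Proof.
move=> p0; rewrite /clients (bigD1 p) //= [in RHS](bigD1 p) //= ffunE eqxx.
rewrite [RHS]addnAC addnC addnA; congr (_ + _).
by apply: eq_bigr => i /andP [_ /negbTE neq_i]; rewrite ffunE neq_i.
Qed.

Lemma sum_upd0 pc k :
  clients (upd pc ord0 k) = clients pc.
Proof. by rewrite /clients; apply: eq_bigr => i /negbTE neq_i; rewrite ffunE neq_i. Qed.

Lemma syncing_live InvT :
  (forall vis, (forall p, vis p != set0) -> InvT [ffun => s2] [ffun => 0] vis) ->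
  live_invariant tail InvT ->
  live_invariant sync_machine
    (fun g pc vis => syncing g pc vis \/ synced InvT g pc vis).
Proof.
move=> init_inv invT g pc vis [[lt_pc0 le_pc Es E vis_pc]|syn]; last first.
  have [live step] := synced_live invT syn; split=> // p rm.
  by have := step p rm; rewrite /step_ok; case: (sync_machine _ _ _) => [[[k w] []]|] //; right.
have sp0 := cnt_split g0; have sp := cnt_split g; have le_sum := sum_clients le_pc.
have end0 : sync_end ord0 = strays + swaps by [].
split.
  case: (ltnP (pc ord0) strays) => [lt_s|le_s].
    case: (@cntP _ _ g stray) => [|rm str]; first by lia.
    by exists ord0, rm; rewrite /sync_machine lt_pc0 eqxx lt_s str.
  case: (posnP (num g s0)) => [no0|/cntP [rm /= is0]]; last first.
    by exists ord0, rm; rewrite /sync_machine lt_pc0 eqxx ltnNge le_s is0.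
  case: (boolP [exists p, (p != ord0) && (pc p < r.+1)]) => [|/existsPn full].
    case/existsP=> p /andP [/negbTE p0 lt_p].
    have /cntP [rm /= is2] : 0 < num g s2 by lia.
    by exists p, rm; rewrite /sync_machine /sync_end p0 lt_p is2.
  have : n.+1 * r.+1 <= clients pc.
    have -> : n.+1 * r.+1 = \sum_(p : 'I_n.+2 | p != ord0) r.+1.
      by rewrite sum_nat_const cardC1 card_ord.
    by apply: leq_sum => p p0; have := full p; rewrite p0 /= -leqNgt.
  by move: lt_pc0; rewrite end0 /swaps; lia.
have next g' pc' vis' : (forall p, pc' p <= sync_end p) ->
    cnt g' stray + minn (pc' ord0) strays = strays ->
    num g' s2 + clients pc' =
      num g0 s2 + (pc' ord0 - strays) ->
    (forall p, 0 < pc' p -> vis' p != set0) ->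
    syncing g' pc' vis' \/ synced InvT g' pc' vis'.
  move=> le_pc' Es' E' vis_pc'.
  case: (ltnP (pc' ord0) (sync_end ord0)) => [lt0|ge0]; first by left; split.
  by right; apply: sync_finished => //; apply/eqP; rewrite eqn_leq le_pc'.
move=> p rm; rewrite /step_ok.
have visN (p' : 'I_n.+2) : 0 < pc p' -> visit vis p rm p' != set0.
  by move=> pos; apply: (visit_gt0 rm vis_pc); right.
have visS k (p' : 'I_n.+2) : 0 < upd pc p k p' -> visit vis p rm p' != set0.
  move=> pos; apply: (visit_gt0 rm vis_pc); move: pos.
  by rewrite /upd ffunE; case: eqP => [->|_ pos]; [left|right].
have leS : pc p < sync_end p -> forall p', upd pc p (pc p).+1 p' <= sync_end p'.
  by move=> lt_p p'; rewrite ffunE; case: eqP => [->|].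
have cs := cnt_upd g rm s0 stray; have c2 := num_upd g rm s0 s2.
have cs' := cnt_upd g rm s2 stray; have c2' := num_upd g rm s2 s2.
have [st0 st2] : stray s0 = false /\ stray s2 = false.
  by rewrite /stray !eqxx andbF.
rewrite st0 st2 /= eqxx (negbTE s02) in cs c2 cs' c2'.
case: (eqVneq p ord0) => [p0|p0]; last first.
  rewrite /sync_machine /sync_end (negbTE p0).
  case: ltnP => [lt_p|ge_p].
    case: eqP => [is2|_]; last by apply: next.
    rewrite is2 st2 eqxx /= in cs c2.
    have upd0 : upd pc p (pc p).+1 ord0 = pc ord0 by rewrite ffunE eq_sym (negbTE p0).
    have upd_p := sum_upd pc (pc p).+1 p0.
    apply: next; rewrite ?upd0; [|lia|lia|exact: visS].
    by apply: leS; rewrite /sync_end (negbTE p0).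
  (* If a stray were left, [pc ord0 - strays] would be 0 and the balance would bound this client's
     [r.+1] moves by [num g0 s2 <= r]. So the room shows s0 or s2, where [tail] is idle. *)
  have [-> ns] : pc p - r.+1 = 0 /\ cnt g stray = 0.
    have := le_pc p; rewrite /sync_end (negbTE p0) => le_p; split; first by lia.
    by move: E; rewrite /clients (bigD1 p) //=; lia.
  have [t0 t2] := tail_idle p0.
  have -> : tail p 0 (g rm) = None.
    have := cnt0 ns rm; rewrite /stray.
    by case: eqP => [->//|_]; case: eqP => [->|].
  exact: next.
rewrite p0 in visS leS *.
have upd0 : upd pc ord0 (pc ord0).+1 ord0 = (pc ord0).+1 by rewrite ffunE eqxx.
rewrite /sync_machine lt_pc0 eqxx; case: ltnP => lt_s.
  case: ifP => [str|_]; last by rewrite -p0; apply: next.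
  move: (str) => /andP [n0 /negbTE n2]; rewrite str n2 /= in cs c2.
  apply: next; rewrite ?upd0 ?sum_upd0; [exact: leS|lia|lia|exact: visS].
case: eqP => [is0|_]; last by rewrite -p0; apply: next.
rewrite is0 st0 (negbTE s02) /= in cs' c2'.
by apply: next; rewrite ?upd0 ?sum_upd0; [exact: leS|lia|lia|exact: visS].
Qed.

Lemma sync_bounded B :
  bounded_machine tail B ->
  bounded_machine sync_machine (strays + swaps + r.+1 + B).
Proof.
move=> tailB p k c k' w b; rewrite /sync_machine.
have le_end : sync_end p <= strays + swaps + r.+1 by rewrite /sync_end; case: eqP; lia.
case: ltnP => [lt_k|ge_k].
  by do ?case: ifP => _ //; case=> <- _ _; lia.
case E: (tail _ _ _) => [[[j v] b']|] // [<- _ _].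
by have := tailB _ _ _ _ _ _ E; lia.
Qed.

(** Reduces the game to a [tail] started with all rooms in s2. Of the visits made so far only
    nonemptiness is passed on, which is what a single room calls for. *)
Theorem sync_winning B InvT :
  bounded_machine tail B -> live_invariant tail InvT ->
  (forall vis, (forall p, vis p != set0) -> InvT [ffun => s2] [ffun => 0] vis) ->
  exists st : strategy n.+2 q, winning init st.
Proof.
move=> tailB invT init_inv; exists (strategy_of sync_machine s0).
apply: machine_winning (sync_bounded tailB) (syncing_live init_inv invT) _.
left; split; rewrite /sync_end ?ffunE ?eqxx.
- by rewrite /swaps mulSn; lia.
- by move=> p; rewrite ffunE.
- by rewrite min0n addn0.
- by rewrite /clients big1 // => p _; rewrite ffunE.
- by move=> p; rewrite ffunE.
Qed.

End Synchronisation.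

(** * What the unvisited rooms can show *)

Section Confinement.

Variables n r q : nat.
Implicit Types (g : {ffun 'I_r -> 'I_q}) (vis : {ffun 'I_n -> {set 'I_r}}).
Implicit Types (S : pred 'I_q).

Definition confined g vis (p : 'I_n) S : Prop :=
  forall rm, rm \notin vis p -> S (g rm).

Lemma confined_visited g vis p : confined g vis p pred0 -> forall rm, rm \in vis p.
Proof. by move=> conf rm; apply/negPn/negP => /conf. Qed.

Lemma confined_sub g vis p S S' :
  confined g vis p S -> (forall rm, S (g rm) -> S' (g rm)) -> confined g vis p S'.
Proof. by move=> conf sub rm /conf /sub. Qed.

Lemma visit_self vis p (rm : 'I_r) : visit vis p rm p = rm |: vis p.
Proof. by rewrite /visit ffunE eqxx. Qed.

Lemma confined_visit g vis p p' (rm : 'I_r) S :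
  confined g vis p S -> confined g (visit vis p' rm) p S.
Proof.
move=> conf i; rewrite /visit ffunE; case: eqP => [<-|_ /conf //].
by rewrite in_setU1 negb_or => /andP [_ /conf].
Qed.

Lemma confined_upd_other g vis p p' (rm : 'I_r) w S :
  confined g vis p S -> (S (g rm) -> S w) ->
  confined (upd g rm w) (visit vis p' rm) p S.
Proof.
move=> conf Sw i nvis; have Si := confined_visit conf nvis.
by rewrite ffunE; case: eqP Si => [->|].
Qed.

(** The new state [w] is arbitrary because the overwritten room has just been visited by [p]
    itself. *)
Lemma confined_upd_self g vis p (rm : 'I_r) w S :
  confined g vis p S -> confined (upd g rm w) (visit vis p rm) p S.
Proof.
move=> conf i; rewrite visit_self in_setU1 negb_or ffunE.
by case/andP=> /negbTE -> /conf.
Qed.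

Lemma confined_see g vis p (rm : 'I_r) w S :
  (forall i, i != rm -> S (g i)) -> confined (upd g rm w) (visit vis p rm) p S.
Proof.
move=> Sg i; rewrite visit_self in_setU1 negb_or ffunE.
by case/andP=> neq _; rewrite (negbTE neq) Sg.
Qed.

End Confinement.

(** * One room *)

Section OneRoom.

Variables (n q : nat) (s0 s2 : 'I_q).

(** With one room, a nonempty visited set is everything, so synchronisation alone settles the case
    and [ord0] declares at its next visit. *)
Definition one_room_machine : machine n.+2 q := fun p k c =>
  if (p == ord0) && (k == 0) then Some (1, c, true) else None.

Lemma one_room_winning (init : 'I_1 -> 'I_q) :
  s0 != s2 -> exists st : strategy n.+2 q, winning init st.
Proof.
move=> s02; apply: (@sync_winning _ _ _ s0 s2 one_room_machine init _ s02 _ 1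
  (fun g pc vis => pc ord0 = 0 /\ forall p, vis p != set0)) => //.
- by move=> p /negbTE p0; rewrite /one_room_machine p0.
- move=> p k c k' w b; rewrite /one_room_machine.
  by case: eqP => //; case: k => //= _ [<-].
- move=> g pc vis [pc0 vis0].
  have all p rm : rm \in vis p.
    by case/set0Pn: (vis0 p) => i; rewrite (ord1 i) (ord1 rm).
  split; first by exists ord0, ord0; rewrite /one_room_machine pc0.
  move=> p rm; rewrite /step_ok /one_room_machine.
  have vis' p' : visit vis p rm p' != set0.
    by apply/set0Pn; exists ord0; rewrite /visit ffunE; case: eqP => _; rewrite ?in_setU1 all ?orbT.
  case: ifP => _; last by [].
  by move=> p' rm'; case/set0Pn: (vis' p') => i; rewrite (ord1 i) (ord1 rm').
- by move=> vis vis0; rewrite ffunE.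
Qed.

End OneRoom.

(** * Configurations with three states *)

Section ThreeStates.

Variables r q : nat.
Variables s0 s1 s2 : 'I_q.
Implicit Types (g : {ffun 'I_r -> 'I_q}).

(** For distinct s0, s1, s2 the last conjunct says that no further state occurs. *)
Definition nums g a b c : Prop :=
  [/\ num g s0 = a, num g s1 = b, num g s2 = c & a + b + c = r].

Lemma num_pos g c rm : g rm = c -> 0 < num g c.
Proof. by move=> Eg; apply: (cnt_gt0 (rm := rm)); rewrite /= Eg. Qed.

Lemma num_find g c : 0 < num g c -> exists rm, g rm = c.
Proof. by case/cntP=> rm /eqP; exists rm. Qed.

Lemma nums_upd g a b c a' b' c' rm w : nums g a b c ->
  [&& a' + (g rm == s0) == a + (w == s0), b' + (g rm == s1) == b + (w == s1),
      c' + (g rm == s2) == c + (w == s2) & a' + b' + c' == r] ->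
  nums (upd g rm w) a' b' c'.
Proof.
case=> <- <- <- full /and4P [/eqP Ea /eqP Eb /eqP Ec /eqP full'].
have := num_upd g rm w s0; have := num_upd g rm w s1; have := num_upd g rm w s2.
by split=> //; lia.
Qed.

Hypotheses (s01 : (s0 == s1) = false) (s02 : (s0 == s2) = false)
  (s12 : (s1 == s2) = false).

Let s10 : (s1 == s0) = false. Proof. by rewrite eq_sym. Qed.
Let s20 : (s2 == s0) = false. Proof. by rewrite eq_sym. Qed.
Let s21 : (s2 == s1) = false. Proof. by rewrite eq_sym. Qed.

Lemma nums_see g a b c rm : nums g a b c ->
  [\/ g rm = s0 /\ 0 < a, g rm = s1 /\ 0 < b | g rm = s2 /\ 0 < c].
Proof.
case=> <- <- <- full.
have : cnt g [pred x | [|| x == s0, x == s1 | x == s2]] = r.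
  rewrite -[RHS]full /num /cnt -!big_split; apply: eq_bigr => i _ /=.
  case: (g i =P s0) => [->|_]; first by rewrite s01 s02.
  by case: (g i =P s1) => [->|_]; rewrite ?s12 //; case: eqP.
move/cnt_full/(_ rm) => /= /or3P [] /eqP E; [constructor 1|constructor 2|constructor 3];
  by split=> //; apply: (cnt_gt0 (rm := rm)); rewrite /= E.
Qed.

(** A limit set can shrink without any visit: a state shown by no room at all may be dropped from
    it. *)
Lemma confined_nums n (vis : {ffun 'I_n -> {set 'I_r}}) g p (S S' : pred 'I_q) a b c :
  confined g vis p S -> nums g a b c ->
  [&& (0 < a) ==> S s0 ==> S' s0, (0 < b) ==> S s1 ==> S' s1
    & (0 < c) ==> S s2 ==> S' s2] ->
  confined g vis p S'.
Proof.
move=> conf N /and3P [/implyP S0 /implyP S1 /implyP S2].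
apply: (confined_sub conf) => rm.
by case: (nums_see rm N) => -[-> /[dup] ? pos]; apply/implyP; [apply: S0|apply: S1|apply: S2].
Qed.

Lemma nums_const : nums [ffun => s2] 0 0 r.
Proof.
split=> //; rewrite /num /cnt.
- by rewrite big1 // => i _; rewrite ffunE /= s20.
- by rewrite big1 // => i _; rewrite ffunE /= s21.
- by rewrite -[RHS]card_ord -sum1_card; apply: eq_bigr => i _; rewrite ffunE /= eqxx.
Qed.

End ThreeStates.

(** * Two rooms *)

Section TwoRooms.

Variables (n q : nat) (s0 s1 s2 : 'I_q).
Hypotheses (s01 : (s0 == s1) = false) (s02 : (s0 == s2) = false)
  (s12 : (s1 == s2) = false).

Let s10 : (s1 == s0) = false. Proof. by rewrite eq_sym. Qed.
Let s20 : (s2 == s0) = false. Proof. by rewrite eq_sym. Qed.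
Let s21 : (s2 == s1) = false. Proof. by rewrite eq_sym. Qed.

(* After a sweep s2 -> s0, prisoner [ord0] fixes one room to s1. A client that has
   seen this s1 and then an s0 has been in both rooms; it reports by s0 -> s2. *)
Definition two_room_machine : machine n.+2 q := fun p k c =>
  if p == ord0 then
    if k < 2 then (if c == s2 then Some (k.+1, s0, false) else None)
    else if k == 2 then (if c == s0 then Some (k.+1, s1, false) else None)
    else if k <= n + 3 then (if c == s2 then Some (k.+1, s0, k == n + 3) else None)
    else None
  else
    if k == 0 then (if c == s1 then Some (1, s1, false) else None)
    else if k == 1 then (if c == s0 then Some (2, s2, false) else None)
    else None.

(** A client has reported exactly at counter 2; the predecessor maps the counters 0, 1, 2 to 0, 0,
    1. *)
Definition acks (pc : {ffun 'I_n.+2 -> nat}) : nat :=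
  \sum_(p | p != ord0) (pc p).-1.

(** The first alternative is the sweep, the second the reporting phase: [n2] tells whether a report
    is pending, and [pc ord0 - 3] reports have been collected. *)
Definition two_room_inv : state_pred n.+2 2 q := fun g pc vis =>
  [/\ pc ord0 <= 2, forall p, p != ord0 -> pc p = 0,
      nums s0 s1 s2 g (pc ord0) 0 (2 - pc ord0)
    & confined g vis ord0 (pred1 s2)] \/
  (exists n2, [/\ 2 < pc ord0 <= n + 3 /\ n2 <= 1,
      nums s0 s1 s2 g (1 - n2) 1 n2, acks pc = (pc ord0 - 3) + n2,
      confined g vis ord0 pred0
    & forall p, p != ord0 ->
        [/\ pc p <= 2, pc p = 1 -> confined g vis p (predC1 s1)
          & pc p = 2 -> confined g vis p pred0]]).

Lemma acks_upd pc p k : p != ord0 ->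
  acks (upd pc p k) + (pc p).-1 = acks pc + k.-1.
Proof.
move=> p0; rewrite /acks (bigD1 p) //= [in RHS](bigD1 p) //= ffunE eqxx.
rewrite [RHS]addnAC addnC addnA; congr (_ + _).
by apply: eq_bigr => i /andP [_ /negbTE neq_i]; rewrite ffunE neq_i.
Qed.

Lemma acks_upd0 pc k : acks (upd pc ord0 k) = acks pc.
Proof. by apply: eq_bigr => i /negbTE neq_i; rewrite ffunE neq_i. Qed.

Lemma acks_full (pc : {ffun 'I_n.+2 -> nat}) : (forall p, p != ord0 -> pc p <= 2) -> acks pc = n.+1 ->
  forall p, p != ord0 -> pc p = 2.
Proof.
move=> le2 full p p0.
have : \sum_(i | i != ord0) (1 - (pc i).-1) + acks pc = n.+1.
  rewrite /acks -big_split /=.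
  have ones : \sum_(i : 'I_n.+2 | i != ord0) 1 = n.+1.
    by rewrite sum_nat_const cardC1 card_ord muln1.
  by rewrite -[RHS]ones; apply: eq_bigr => i /le2; lia.
rewrite full -[RHS]add0n => /addIn/eqP; rewrite sum_nat_eq0 => /forallP/(_ p).
by rewrite p0 /= => /eqP; have := le2 p p0; lia.
Qed.

Lemma two_room_live : live_invariant two_room_machine two_room_inv.
Proof.
move=> g pc vis [[le2 idle N conf0]|[n2 [[pc0 le_n2] N E conf0 confs]]].
  split.
    case: (ltnP (pc ord0) 2) => [lt2|ge2].
      case: (@num_find _ _ g s2) => [|rm Eg]; first by case: N => _ _ -> _; lia.
      by exists ord0, rm; rewrite /two_room_machine lt2 Eg !eqxx.
    have pc2 : pc ord0 = 2 by lia.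
    case: (@num_find _ _ g s0) => [|rm Eg]; first by case: N => -> _ _ _; lia.
    by exists ord0, rm; rewrite /two_room_machine pc2 Eg !eqxx.
  move=> p rm; rewrite /step_ok /two_room_machine.
  case: (p =P ord0) => [->|/eqP p0]; last first.
    rewrite (idle _ p0) /=; case: eqP => [is1|_].
      by have := num_pos is1; case: N => _ ->.
    by left; split=> //; apply: confined_visit.
  have upd0 k : upd pc ord0 k ord0 = k by rewrite ffunE eqxx.
  have updN k p' : p' != ord0 -> upd pc ord0 k p' = pc p'.
    by move/negbTE => neq; rewrite ffunE neq.
  case: ltnP => [lt2|ge2].
    case: eqP => [is2|_]; last by left; split=> //; apply: confined_visit.
    left; split; rewrite ?upd0 //; first by move=> p' p'0; rewrite updN ?idle.
      by apply: (nums_upd N); rewrite is2 !eqxx s20 s21 s02 s01; lia.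
    exact: confined_upd_self.
  have pc2 : pc ord0 = 2 by lia.
  rewrite pc2 /=; case: eqP => [is0|_]; last first.
    by left; split=> //; apply: confined_visit.
  right; exists 0; split; rewrite ?upd0 ?acks_upd0 //; first by lia.
  - by apply: (nums_upd N); rewrite is0 !eqxx s01 s02 s10 s12 pc2.
  - by rewrite /acks big1 // => p' /idle ->.
  - apply: confined_upd_self; apply: (confined_nums s01 s02 s12 conf0 N).
    by rewrite pc2 /= s02.
  - by move=> p' p'0; rewrite updN // idle.
split.
  case: (posnP n2) => [n20|pos2]; last first.
    case: (@num_find _ _ g s2) => [|rm Eg]; first by case: N => _ _ -> _; lia.
    exists ord0, rm; rewrite /two_room_machine Eg !eqxx.
    by rewrite ltnNge; case: (pc ord0) pc0 => [|[|[|k]]] //= ->.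
  (* With no report pending, [acks pc = pc ord0 - 3 <= n], so one of the [n.+1] clients has yet to
     report. *)
  have [p p0 lt_p] : exists2 p, p != ord0 & pc p < 2.
    case: (boolP [exists p, (p != ord0) && (pc p < 2)]).
      by case/existsP=> p /andP []; exists p.
    move/existsPn=> full.
    have : n.+1 <= acks pc.
      have -> : n.+1 = \sum_(p : 'I_n.+2 | p != ord0) 1.
        by rewrite sum_nat_const cardC1 card_ord muln1.
      by apply: leq_sum => p p0; have := full p; rewrite p0 /=; lia.
    by lia.
  case: (posnP (pc p)) => [pc_p|pc_p].
    case: (@num_find _ _ g s1) => [|rm Eg]; first by case: N => _ -> _ _.
    by exists p, rm; rewrite /two_room_machine (negbTE p0) pc_p Eg !eqxx.
  case: (@num_find _ _ g s0) => [|rm Eg]; first by case: N => -> _ _ _; lia.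
  exists p, rm.
  have pc_1 : pc p = 1 by lia.
  by rewrite /two_room_machine (negbTE p0) pc_1 Eg !eqxx.
have keep p rm : two_room_inv g pc (visit vis p rm).
  right; exists n2; split=> //; first exact: confined_visit.
  move=> p' /confs [? c1 c2].
  by split=> // Ep; apply: confined_visit; [apply: c1|apply: c2].
move=> p rm; rewrite /step_ok /two_room_machine.
case: (p =P ord0) => [->|/eqP p0]; last first.
  have [le_p c1 c2] := confs p p0.
  have upd0 k : upd pc p k ord0 = pc ord0 by rewrite ffunE eq_sym (negbTE p0).
  have updp k : upd pc p k p = k by rewrite ffunE eqxx.
  have updN k p' : p' != p -> upd pc p k p' = pc p'.
    by move/negbTE => neq; rewrite ffunE neq.
  have others w : (g rm != s1 -> w != s1) -> forall p', p' != ord0 -> p' != p ->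
    [/\ pc p' <= 2, pc p' = 1 -> confined (upd g rm w) (visit vis p rm) p' (predC1 s1)
     & pc p' = 2 -> confined (upd g rm w) (visit vis p rm) p' pred0].
    move=> ww p' /confs [? d1 d2] _.
    by split=> // Ep; apply: confined_upd_other => //; [apply: d1|apply: d2].
  case: (posnP (pc p)) => [pc_p|pc_p].
    case: eqP => [is1|_]; last exact: keep.
    right; exists n2; split; rewrite ?upd0 //.
    - by apply: (nums_upd N); rewrite is1 !eqxx; case: N => *; lia.
    - by have := acks_upd pc 1 p0; rewrite pc_p /= !addn0 => ->.
    - exact: confined_upd_other.
    move=> p' p'0; case: (eqVneq p' p) => [->|neq]; last first.
      by rewrite updN //; apply: others => //; rewrite is1 eqxx.
    rewrite updp; split=> // _; apply: confined_see => i neq_i.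
    by apply: (cnt1 (P := pred1 s1)) neq_i => /=; [case: N|rewrite is1 eqxx].
  case: eqP => [pc_1|_]; last exact: keep.
  case: eqP => [is0|_]; last exact: keep.
  have n20 : n2 = 0 by have := num_pos is0; case: N => -> _ _ _; lia.
  right; exists 1; split; rewrite ?upd0 //.
  - by apply: (nums_upd N); rewrite is0 n20 !eqxx s01 s02 s20 s21.
  - by have := acks_upd pc 2 p0; rewrite pc_1 E n20 /= !addn0.
  - exact: confined_upd_other.
  move=> p' p'0; case: (eqVneq p' p) => [->|neq]; last first.
    by rewrite updN //; apply: others => //; rewrite s21.
  (* Only one of the two rooms is not s1, namely the visited [rm]. A missed room would be a second
     one, since by [c1] it does not show s1. *)
  rewrite updp; split=> // _ i; rewrite visit_self in_setU1 negb_or => /andP [neq_i].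
  move/(c1 pc_1) => /= /negP no1; case: no1.
  have := @cnt1 _ _ g (predC1 s1) rm _ _ i neq_i; rewrite /= is0 s01 => not2.
  apply/negPn; apply: not2 => //.
  by have := cnt_predC g (pred1 s1); case: N => _; rewrite /num => -> _ _ /= [].
have upd0 k : upd pc ord0 k ord0 = k by rewrite ffunE eqxx.
have updN k p' : p' != ord0 -> upd pc ord0 k p' = pc p'.
  by move/negbTE => neq; rewrite ffunE neq.
rewrite ltnNge; case: (pc ord0 =P 2) pc0 => [->//|_ pc0]; rewrite ltnW /=; last by lia.
case: leqP => [le_pc|_]; last exact: keep.
case: eqP => [is2|_]; last exact: keep.
have n21 : n2 = 1 by have := num_pos is2; case: N => _ _ -> _; lia.
case: (pc ord0 =P n + 3) => [pc_end|pc_lt].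
  move=> p' rm'; apply: (confined_visited (g := g)).
  apply: confined_visit; case: (eqVneq p' ord0) => [->//|p'0].
  have [le_p _ c2] := confs p' p'0; apply: c2.
  by apply: (acks_full _ _ p'0) => [i /confs []//|]; rewrite E n21 pc_end; lia.
right; exists 0; split; rewrite ?upd0 ?acks_upd0 //.
- by lia.
- by apply: (nums_upd N); rewrite is2 n21 !eqxx s01 s02 s20 s21.
- by rewrite E n21; lia.
- exact: confined_upd_self.
move=> p' p'0; rewrite updN //; have [le_p c1 c2] := confs p' p'0.
by split=> // Ep; apply: confined_upd_other => //=; rewrite ?s01 //; [apply: c1|apply: c2].
Qed.

Lemma two_room_winning (init : 'I_2 -> 'I_q) :
  exists st : strategy n.+2 q, winning init st.
Proof.
apply: (@sync_winning _ _ _ s0 s2 two_room_machine init _ _ _ (n + 4) two_room_inv).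
- by [].
- by rewrite s02.
- by move=> p /negbTE p0; rewrite /two_room_machine p0 s01 s21.
- move=> p k c k' w b; rewrite /two_room_machine.
  by do ![case: ifP => ?|case: eqP => ?] => //; case=> <- _ _; lia.
- exact: two_room_live.
move=> vis _; left; split; rewrite ?ffunE //.
- by move=> p _; rewrite ffunE.
- exact: nums_const.
by move=> rm _; rewrite ffunE /= eqxx.
Qed.

End TwoRooms.

(** * Four or more rooms *)

Section ManyRooms.

Variables (r q : nat) (s0 s1 s2 : 'I_q).
Hypotheses (r4 : 3 < r) (s01 : (s0 == s1) = false) (s02 : (s0 == s2) = false)
  (s12 : (s1 == s2) = false).
Implicit Types (g : {ffun 'I_r -> 'I_q}) (pc : {ffun 'I_5 -> nat}).
Implicit Types (vis : {ffun 'I_5 -> {set 'I_r}}).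

Let s10 : (s1 == s0) = false. Proof. by rewrite eq_sym. Qed.
Let s20 : (s2 == s0) = false. Proof. by rewrite eq_sym. Qed.
Let s21 : (s2 == s1) = false. Proof. by rewrite eq_sym. Qed.
Let sE := (eqxx, s01, s02, s12, s10, s20, s21).

Local Notation P0 := (@ord0 4).
Local Notation P1 := (@Ordinal 5 1 isT).
Local Notation P2 := (@Ordinal 5 2 isT).
Local Notation P3 := (@Ordinal 5 3 isT).
Local Notation P4 := (@Ordinal 5 4 isT).

Lemma ord5P (p : 'I_5) : [\/ p = P0, p = P1, p = P2 | p = P3 \/ p = P4].
Proof.
case: p => -[|[|[|[|[|//]]]]] lt;
  [constructor 1|constructor 2|constructor 3|constructor 4; left|constructor 4; right];
  exact: val_inj.
Qed.

Definition rule (k : nat) (c a b : 'I_q) : option (nat * 'I_q * bool) :=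
  if c == a then Some (k.+1, b, false) else None.

(** Beyond [3 * r + 2], where a worker that came first stops, so the two roles have disjoint counter
    ranges and the jump increases the counter. *)
Let second := 3 * r + 3.

(* A worker takes the unique s0 (step 2) and assumes that it is the first to do so.
   If it sees another s0 before it has turned r - 2 rooms from s2 to s1, it is the
   second one: it jumps to the counter [second] and turns everything into s0. *)
Definition worker (k : nat) (c : 'I_q) : option (nat * 'I_q * bool) :=
  if k == 0 then rule k c s1 s1
  else if k == 1 then rule k c s2 s2
  else if k == 2 then rule k c s0 s1
  else if k <= r then
    (if c == s0 then Some (second, s0, false) else rule k c s2 s1)
  else if k <= 2 * r then rule k c s1 s2
  else if k < 3 * r then rule k c s2 s1
  else if k <= 3 * r + 1 then rule k c s1 s0
  else if second <= k < second + r.-1 then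
    (if c == s0 then None else Some (k.+1, s0, k.+1 == second + r.-1))
  else None.

(** After its sweep each prisoner plants the signal for the next: s1 by prisoner 0, s2 by prisoner
    1. Prisoner 2 restores one s1 for workers that have not seen any, and then plants the contested
    s0. *)
Definition many_room_machine : machine 5 q := fun p k c =>
  match val p with
  | 0 => if k < r then rule k c s2 s0
         else if k == r then rule k c s0 s1 else None
  | 1 => if k == 0 then rule k c s1 s1
         else if k < r then rule k c s0 s1
         else if k == r then rule k c s1 s2 else None
  | 2 => if k == 0 then rule k c s1 s1
         else if k == 1 then rule k c s2 s2
         else if k <= r then rule k c s1 s2
         else if k == r.+1 then rule k c s2 s1
         else if k == r.+2 then rule k c s2 s0 else None
  | _ => worker k c
  end.

(* What a prisoner has not visited yet shows a symbol in its limit set. *)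
Definition worker_lim (k : nat) : pred 'I_q :=
  if k <= r then predT else if k <= 2 * r then pred1 s1
  else if k < second then pred0 else predC1 s0.

Definition lim (p : 'I_5) (k : nat) : pred 'I_q :=
  match val p with
  | 0 => if k <= r then pred1 s2 else pred0
  | 1 => if k == 0 then predT else if k <= r then pred1 s0 else pred0
  | 2 => if k <= 1 then predT else if k <= r.+1 then pred1 s1 else pred0
  | _ => worker_lim k
  end.

(** Prisoner 0 acts in E1, prisoner 1 in E2 and E3, prisoner 2 from E4 to E6, and in E7 the s0
    awaits a worker. The bounds on [c], [d], [e] say which signals can have been seen: s1 from E2
    on, s2 after it from E4 on. *)
Inductive early (a b c d e n0 n1 n2 : nat) : Prop :=
| E1 of a <= r & b = 0 & c = 0 & d = 0 & e = 0 & n0 = a & n1 = 0 & n2 = r - a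
| E2 of a = r.+1 & b = 0 & c <= 1 & d <= 1 & e <= 1 & n0 = r - 1 & n1 = 1 & n2 = 0
| E3 of a = r.+1 & 0 < b <= r & c <= 1 & d <= 1 & e <= 1
    & n0 = r - b & n1 = b & n2 = 0
| E4 of a = r.+1 & b = r.+1 & c <= 1 & d <= 2 & e <= 2
    & n0 = 0 & n1 = r - 1 & n2 = 1
| E5 of a = r.+1 & b = r.+1 & 1 < c <= r.+1 & d <= 2 & e <= 2
    & n0 = 0 & n1 = r.+1 - c & n2 = c - 1
| E6 of a = r.+1 & b = r.+1 & c = r.+2 & d <= 2 & e <= 2
    & n0 = 0 & n1 = 1 & n2 = r - 1
| E7 of a = r.+1 & b = r.+1 & c = r.+3 & d <= 2 & e <= 2
    & n0 = 1 & n1 = 1 & n2 = r - 2.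

(* x is the counter of the worker that took the first s0, y that of the other.
   In L5 at most one s2 is left, so y cannot complete its r - 2 >= 2 conversions:
   this is where r <> 3 is needed. *)
Inductive late (x y n0 n1 n2 : nat) : Prop :=
| L1 of 2 < x <= r & y <= 2 & n0 = 0 & n1 = x - 1 & n2 = r.+1 - x
| L2 of r < x <= 2 * r & y <= 2 & n0 = 0 & n1 = 2 * r + 1 - x & n2 = x - r.+1
| L3 of 2 * r < x <= 3 * r & y <= 2 & n0 = 0 & n1 = x - (2 * r).+1
    & n2 = 3 * r + 1 - x
| L4 of 3 * r < x <= 3 * r + 2 & y <= 2 & n0 = x - 3 * r & n1 = 4 * r - 1 - x
    & n2 = 1
| L5 of 3 * r < x <= 3 * r + 2 & 2 < y <= 4 & n0 = x - (3 * r).+1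
    & n1 = 4 * r + y - 3 - x & n2 = 4 - y
| L6 of x = 3 * r + 2 & second <= y < second + r.-1 & n0 = (y - second).+1.

Definition confs g pc vis : Prop := forall p, confined g vis p (lim p (pc p)).

Definition early_inv : state_pred 5 r q := fun g pc vis =>
  exists a b c d e n0 n1 n2,
    [/\ [/\ pc P0 = a, pc P1 = b, pc P2 = c, pc P3 = d & pc P4 = e],
        nums s0 s1 s2 g n0 n1 n2, early a b c d e n0 n1 n2 & confs g pc vis].

(** [X] is the worker that won the race, so one argument serves both outcomes. *)
Definition late_inv (X Y : 'I_5) : state_pred 5 r q := fun g pc vis =>
  exists x y n0 n1 n2,
    [/\ [/\ pc P0 = r.+1, pc P1 = r.+1, pc P2 = r.+3, pc X = x & pc Y = y],
        nums s0 s1 s2 g n0 n1 n2, late x y n0 n1 n2 & confs g pc vis].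

Definition many_room_inv : state_pred 5 r q := fun g pc vis =>
  [\/ early_inv g pc vis, late_inv P3 P4 g pc vis | late_inv P4 P3 g pc vis].

(** The truncated subtractions are exact, since the state shown by [rm] has a positive count. *)
Lemma nums_move g n0 n1 n2 rm w : nums s0 s1 s2 g n0 n1 n2 ->
  [|| w == s0, w == s1 | w == s2] ->
  nums s0 s1 s2 (upd g rm w) (n0 - (g rm == s0) + (w == s0))
    (n1 - (g rm == s1) + (w == s1)) (n2 - (g rm == s2) + (w == s2)).
Proof.
move=> N ws; apply: (nums_upd N).
have [[Eg pos]|[Eg pos]|[Eg pos]] := nums_see s01 s02 s12 rm N;
  case: N => _ _ _ full; case/or3P: ws => /eqP ->; rewrite Eg !sE /=; lia.
Qed.

Lemma confs_visit g pc vis p rm : confs g pc vis -> confs g pc (visit vis p rm).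
Proof. by move=> C p'; apply: confined_visit. Qed.

Lemma confs_step g pc vis p rm k w : confs g pc vis ->
  (forall p', p' != p -> lim p' (pc p') (g rm) -> lim p' (pc p') w) ->
  confined (upd g rm w) (visit vis p rm) p (lim p k) ->
  confs (upd g rm w) (upd pc p k) (visit vis p rm).
Proof.
move=> C other own p'; case: (eqVneq p' p) => [->|neq].
  by rewrite [upd pc p k p]ffunE eqxx.
rewrite [upd pc p k p']ffunE (negbTE neq); apply: confined_upd_other (C p') _.
exact: other.
Qed.

Lemma own_see g vis p (rm : 'I_r) w c (S : pred 'I_q) : g rm = c -> num g c = 1 ->
  (forall i, g i != c -> S (g i)) ->
  confined (upd g rm w) (visit vis p rm) p S.
Proof.
move=> Eg c1 Sg; apply: confined_see => i neq; apply: Sg.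
by apply: (cnt1 (P := pred1 c) c1 _ neq); rewrite /= Eg.
Qed.

Lemma early_step g pc vis p rm k w a b c d e n0 n1 n2 :
  nums s0 s1 s2 g n0 n1 n2 -> confs g pc vis ->
  [|| w == s0, w == s1 | w == s2] ->
  [/\ upd pc p k P0 = a, upd pc p k P1 = b, upd pc p k P2 = c,
      upd pc p k P3 = d & upd pc p k P4 = e] ->
  early a b c d e (n0 - (g rm == s0) + (w == s0))
    (n1 - (g rm == s1) + (w == s1)) (n2 - (g rm == s2) + (w == s2)) ->
  (forall p', p' != p -> lim p' (pc p') (g rm) -> lim p' (pc p') w) ->
  confined (upd g rm w) (visit vis p rm) p (lim p k) ->
  many_room_inv (upd g rm w) (upd pc p k) (visit vis p rm).
Proof.
move=> N C ws pcs E other own; constructor 1; exists a, b, c, d, e.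
do 3!eexists; split; [exact: pcs|exact: (nums_move rm N ws)|exact: E|exact: confs_step].
Qed.

(** Drops states that are absent after the move, as when the first worker reaches counter [r.+1] and
    all rooms show s1. *)
Lemma own_move g pc vis (p : 'I_5) (rm : 'I_r) w k n0 n1 n2 :
  confs g pc vis -> nums s0 s1 s2 g n0 n1 n2 -> [|| w == s0, w == s1 | w == s2] ->
  [/\ 0 < n0 - (g rm == s0) + (w == s0) -> lim p (pc p) s0 -> lim p k s0,
      0 < n1 - (g rm == s1) + (w == s1) -> lim p (pc p) s1 -> lim p k s1
    & 0 < n2 - (g rm == s2) + (w == s2) -> lim p (pc p) s2 -> lim p k s2] ->
  confined (upd g rm w) (visit vis p rm) p (lim p k).
Proof.
move=> C N ws [l0 l1 l2].
have own : confined (upd g rm w) (visit vis p rm) p (lim p (pc p)).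
  exact: confined_upd_self.
apply: (confined_nums s01 s02 s12 own (nums_move rm N ws)).
by apply/and3P; split; apply/implyP => pos; apply/implyP; [exact: l0|exact: l1|exact: l2].
Qed.

(** Drops states that are absent before the move. This serves prisoner 2 at counter [r.+1]: it has
    exhausted s1 and now writes one back, into a room that it is just visiting. *)
Lemma own_pre g pc vis (p : 'I_5) (rm : 'I_r) w k n0 n1 n2 :
  confs g pc vis -> nums s0 s1 s2 g n0 n1 n2 ->
  [/\ 0 < n0 -> lim p (pc p) s0 -> lim p k s0,
      0 < n1 -> lim p (pc p) s1 -> lim p k s1
    & 0 < n2 -> lim p (pc p) s2 -> lim p k s2] ->
  confined (upd g rm w) (visit vis p rm) p (lim p k).
Proof.
move=> C N [l0 l1 l2]; apply: confined_upd_self.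
apply: (confined_nums s01 s02 s12 (C p) N).
by apply/and3P; split; apply/implyP => pos; apply/implyP; [exact: l0|exact: l1|exact: l2].
Qed.

(** How a sweep begins: the mover stands in the only room showing [c], so the rooms it has missed
    show the remaining states. *)
Lemma seen_alone g n0 n1 n2 vis p (rm : 'I_r) w c (S : pred 'I_q) :
  nums s0 s1 s2 g n0 n1 n2 -> g rm = c -> num g c = 1 ->
  [/\ 0 < n0 -> s0 != c -> S s0, 0 < n1 -> s1 != c -> S s1
    & 0 < n2 -> s2 != c -> S s2] ->
  confined (upd g rm w) (visit vis p rm) p S.
Proof.
move=> N Eg c1 [S0 S1 S2]; apply: own_see Eg c1 _ => i.
by case: (nums_see s01 s02 s12 i N) => -[-> pos]; auto.
Qed.

Local Ltac arith E q pc := clear dependent q; clear dependent pc; case: E => *; lia.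

Local Ltac by_phase E q pc :=
  clear dependent q; clear dependent pc;
  case: E => *; first [exfalso; lia | constructor 1; lia | constructor 2; lia
  | constructor 3; lia | constructor 4; lia | constructor 5; lia
  | constructor 6; lia | constructor 7; lia].

Local Ltac split_ifs := repeat (case: ifP => ?).

Local Ltac fire sE q pc := rewrite /many_room_machine /= /worker /rule !sE; split_ifs => //;
    exfalso; clear dependent q; clear dependent pc; lia.

Local Ltac others Ea Eb Ec Ed Ee Eg E q pc :=
  let p' := fresh in move=> p';
  case: (ord5P p') => [->|->|->|[->|->]]; rewrite ?eqxx // => _;
  rewrite /lim /= /worker_lim ?Ea ?Eb ?Ec ?Ed ?Ee Eg; split_ifs; rewrite /= ?sE //; arith E q pc.

Local Ltac own C N Ei Eg E q pc :=
  first [apply: (own_pre _ C N);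
  rewrite /lim /= /worker_lim Ei; split; split_ifs; rewrite /= ?sE // => *; arith E q pc|
  apply: (own_move C N); [by rewrite !sE|];
  rewrite /lim /= /worker_lim Ei Eg !sE /=; split; split_ifs; rewrite /= ?sE // => *; arith E q pc].

Local Ltac advance tac C N Ei Ea Eb Ec Ed Ee Eg E q pc :=
  tac; [> by rewrite !sE | by split; rewrite ffunE //= | by rewrite Eg !sE /=; by_phase E q pc
  | by others Ea Eb Ec Ed Ee Eg E q pc | try by own C N Ei Eg E q pc ].

Lemma early_live g pc vis : early_inv g pc vis ->
  (exists p rm, many_room_machine p (pc p) (g rm)) /\
  (forall p rm, step_ok many_room_machine many_room_inv g pc vis p rm).
Proof.
move=> [a [b [c [d [e [n0 [n1 [n2 [[Ea Eb Ec Ed Ee] N E C]]]]]]]]].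
have [N0 N1 N2 full] := N.
split.
  have f0 : 0 < n0 -> exists rm, g rm = s0 by rewrite -N0; apply: num_find.
  have f1 : 0 < n1 -> exists rm, g rm = s1 by rewrite -N1; apply: num_find.
  have f2 : 0 < n2 -> exists rm, g rm = s2 by rewrite -N2; apply: num_find.
  have go0 p k : pc p = k -> 0 < n0 -> many_room_machine p k s0 ->
      exists p rm, many_room_machine p (pc p) (g rm).
    by move=> Ep /f0 [rm Erm] H; exists p, rm; rewrite Ep Erm.
  have go1 p k : pc p = k -> 0 < n1 -> many_room_machine p k s1 ->
      exists p rm, many_room_machine p (pc p) (g rm).
    by move=> Ep /f1 [rm Erm] H; exists p, rm; rewrite Ep Erm.
  have go2 p k : pc p = k -> 0 < n2 -> many_room_machine p k s2 ->
      exists p rm, many_room_machine p (pc p) (g rm).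
    by move=> Ep /f2 [rm Erm] H; exists p, rm; rewrite Ep Erm.
  case: E => ea eb ec ed ee e0 e1 e2.
  - case: (ltnP a r) => a_r.
      by apply: (go2 _ _ Ea); [clear dependent q; lia|fire sE q pc].
    by apply: (go0 _ _ Ea); [clear dependent q; lia|fire sE q pc].
  - by apply: (go1 _ _ Eb); [clear dependent q; lia|fire sE q pc].
  - case: (ltnP b r) => b_r.
      by apply: (go0 _ _ Eb); [clear dependent q; lia|fire sE q pc].
    by apply: (go1 _ _ Eb); [clear dependent q; lia|fire sE q pc].
  - case: (posnP c) => c0.
      by apply: (go1 _ _ Ec); [clear dependent q; lia|fire sE q pc].
    by apply: (go2 _ _ Ec); [clear dependent q; lia|fire sE q pc].
  - case: (leqP c r) => c_r.
      by apply: (go1 _ _ Ec); [clear dependent q; lia|fire sE q pc].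
    by apply: (go2 _ _ Ec); [clear dependent q; lia|fire sE q pc].
  - by apply: (go2 _ _ Ec); [clear dependent q; lia|fire sE q pc].
  - case: (posnP d) => d0; first by apply: (go1 _ _ Ed); [clear dependent q; lia|fire sE q pc].
    case: (eqVneq d 1) => d1; first by apply: (go2 _ _ Ed); [clear dependent q; lia|fire sE q pc].
    by apply: (go0 _ _ Ed); [clear dependent q; lia|fire sE q pc].
have keep p rm : many_room_inv g pc (visit vis p rm).
  by constructor 1; exists a, b, c, d, e, n0, n1, n2; split=> //; apply: confs_visit.
move=> p rm; have sees := nums_see s01 s02 s12 rm N.
have go p0 w k a' b' c' d' e' :=
  @early_step g pc vis p0 rm k w a' b' c' d' e' n0 n1 n2 N C.
have goX X Y w k y : [|| w == s0, w == s1 | w == s2] ->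
  X = P3 /\ Y = P4 \/ X = P4 /\ Y = P3 ->
  [/\ upd pc X k P0 = r.+1, upd pc X k P1 = r.+1, upd pc X k P2 = r.+3,
      upd pc X k X = k & upd pc X k Y = y] ->
  late k y (n0 - (g rm == s0) + (w == s0))
    (n1 - (g rm == s1) + (w == s1)) (n2 - (g rm == s2) + (w == s2)) ->
  (forall p', p' != X -> lim p' (pc p') (g rm) -> lim p' (pc p') w) ->
  confined (upd g rm w) (visit vis X rm) X (lim X k) ->
  many_room_inv (upd g rm w) (upd pc X k) (visit vis X rm).
  move=> ws XY pcs L other own.
  have I : late_inv X Y (upd g rm w) (upd pc X k) (visit vis X rm).
    exists k, y; do 3!eexists.
    by split; [exact: pcs|exact: (nums_move rm N ws)|exact: L|exact: confs_step].
  by case: XY I => -[-> ->] I; [constructor 2|constructor 3].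
case: (ord5P p) => [->|->|->|[->|->]]; rewrite /step_ok /many_room_machine /= ?Ea ?Eb ?Ec ?Ed ?Ee /worker /rule;
  case: sees => -[Eg pos]; rewrite Eg !sE; split_ifs; try exact: keep; try (exfalso; arith E q pc).
- by advance ltac:(apply: (go _ _ _ a.+1 b c d e)) C N Ea Ea Eb Ec Ed Ee Eg E q pc.
- by advance ltac:(apply: (go _ _ _ a.+1 b c d e)) C N Ea Ea Eb Ec Ed Ee Eg E q pc.
- by advance ltac:(apply: (go _ _ _ a b.+1 c d e)) C N Eb Ea Eb Ec Ed Ee Eg E q pc.
- advance ltac:(apply: (go _ _ _ a b.+1 c d e)) C N Eb Ea Eb Ec Ed Ee Eg E q pc.
  (* Prisoner 1 takes control at the only s1 (phase E2), while all other rooms show s0. *)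
  refine (seen_alone _ N Eg _ _).
    by rewrite N1; arith E q pc.
  by rewrite /lim /= /worker_lim; split; split_ifs; rewrite /= ?sE // => *; arith E q pc.
- by advance ltac:(apply: (go _ _ _ a b.+1 c d e)) C N Eb Ea Eb Ec Ed Ee Eg E q pc.
- by advance ltac:(apply: (go _ _ _ a b c.+1 d e)) C N Ec Ea Eb Ec Ed Ee Eg E q pc.
- by advance ltac:(apply: (go _ _ _ a b c.+1 d e)) C N Ec Ea Eb Ec Ed Ee Eg E q pc.
- advance ltac:(apply: (go _ _ _ a b c.+1 d e)) C N Ec Ea Eb Ec Ed Ee Eg E q pc.
  (* Prisoner 2 takes control at the only s2 (phase E4), while all other rooms show s1. *)
  refine (seen_alone _ N Eg _ _).
    by rewrite N2; arith E q pc.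
  by rewrite /lim /= /worker_lim; split; split_ifs; rewrite /= ?sE // => *; arith E q pc.
- by advance ltac:(apply: (go _ _ _ a b c.+1 d e)) C N Ec Ea Eb Ec Ed Ee Eg E q pc.
- by advance ltac:(apply: (go _ _ _ a b c.+1 d e)) C N Ec Ea Eb Ec Ed Ee Eg E q pc.
- have [? [? ?]] : a = r.+1 /\ b = r.+1 /\ c = r.+3 by split; [|split]; arith E q pc.
  apply: (goX P3 P4 _ _ e);
    [by rewrite !sE|by [left|right]| | | |].
  + by split; rewrite ffunE //=; lia.
  + by rewrite Eg !sE /=; clear dependent q; case: E => *; first [exfalso; lia|constructor 1; lia].
  + by others Ea Eb Ec Ed Ee Eg E q pc.
  + by own C N Ed Eg E q pc.
- by advance ltac:(apply: (go _ _ _ a b c d.+1 e)) C N Ed Ea Eb Ec Ed Ee Eg E q pc.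
- by advance ltac:(apply: (go _ _ _ a b c d.+1 e)) C N Ed Ea Eb Ec Ed Ee Eg E q pc.
- have [? [? ?]] : a = r.+1 /\ b = r.+1 /\ c = r.+3 by split; [|split]; arith E q pc.
  apply: (goX P4 P3 _ _ d);
    [by rewrite !sE|by [left|right]| | | |].
  + by split; rewrite ffunE //=; lia.
  + by rewrite Eg !sE /=; clear dependent q; case: E => *; first [exfalso; lia|constructor 1; lia].
  + by others Ea Eb Ec Ed Ee Eg E q pc.
  + by own C N Ee Eg E q pc.
- by advance ltac:(apply: (go _ _ _ a b c d e.+1)) C N Ee Ea Eb Ec Ed Ee Eg E q pc.
- by advance ltac:(apply: (go _ _ _ a b c d e.+1)) C N Ee Ea Eb Ec Ed Ee Eg E q pc.
Qed.

Local Ltac lathe L q pc := clear dependent q; clear dependent pc; case: L => *; lia.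

Local Ltac firew sE q pc := rewrite /worker /rule !sE; split_ifs => //;
    exfalso; clear dependent q; clear dependent pc; lia.

Local Ltac num q := clear dependent q; lia.

Local Ltac late_phase L Eg sE x r q pc :=
  rewrite Eg !sE /=; clear dependent q; clear dependent pc;
  case: L => *; case: (ltnP x r) => ?; case: (ltnP x (2 * r)) => ?;
  case: (ltnP x (3 * r)) => ?;
  first [exfalso; lia | constructor 1; lia | constructor 2; lia | constructor 3; lia
  | constructor 4; lia | constructor 5; lia | constructor 6; lia].

Local Ltac late_other L Eg sE q pc :=
  rewrite Eg /worker_lim; split_ifs; rewrite /= ?sE //; lathe L q pc.

Local Ltac late_own C N lX Ex L Eg sE q pc :=
  first [apply: (own_pre _ C N); rewrite !lX Ex /worker_lim;
    split; split_ifs; rewrite /= ?sE // => *; lathe L q pc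
  | apply: (own_move C N); [by rewrite !sE|];
    rewrite !lX Ex Eg !sE /worker_lim; split; split_ifs; rewrite /= ?sE // => *;
    lathe L q pc].

Lemma late_live X Y g pc vis :
  X = P3 /\ Y = P4 \/ X = P4 /\ Y = P3 -> late_inv X Y g pc vis ->
  (exists p rm, many_room_machine p (pc p) (g rm)) /\
  (forall p rm, step_ok many_room_machine many_room_inv g pc vis p rm).
Proof.
move=> XY I; have lateI g' pc' vis' : late_inv X Y g' pc' vis' -> many_room_inv g' pc' vis'.
  by case: XY => -[-> ->]; [constructor 2|constructor 3].
have ordXY p : [\/ p = P0, p = P1, p = P2 | p = X \/ p = Y].
  case: (ord5P p) => [->|->|->|]; [by constructor 1|by constructor 2|by constructor 3|].
  by case: XY => -[-> ->]; constructor 4; tauto.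
have mX k c : many_room_machine X k c = worker k c by case: XY => -[-> _].
have mY k c : many_room_machine Y k c = worker k c by case: XY => -[_ ->].
have lX k : lim X k = worker_lim k by case: XY => -[-> _].
have lY k : lim Y k = worker_lim k by case: XY => -[_ ->].
have [neqX neqY] : [/\ P0 != X, P1 != X, P2 != X & Y != X] /\
    [/\ P0 != Y, P1 != Y, P2 != Y & X != Y] by case: XY => -[-> ->].
case: I => [x [y [n0 [n1 [n2 [[Ea Eb Ec Ex Ey] N L C]]]]]].
have [N0 N1 N2 full] := N.
split.
  have f0 : 0 < n0 -> exists rm, g rm = s0 by rewrite -N0; apply: num_find.
  have f1 : 0 < n1 -> exists rm, g rm = s1 by rewrite -N1; apply: num_find.
  have f2 : 0 < n2 -> exists rm, g rm = s2 by rewrite -N2; apply: num_find.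
  have goX k c0 : pc X = k -> (exists rm, g rm = c0) -> worker k c0 ->
      exists p rm, many_room_machine p (pc p) (g rm).
    by move=> Ep [rm Erm] H; exists X, rm; rewrite Ep Erm mX.
  have goY k c0 : pc Y = k -> (exists rm, g rm = c0) -> worker k c0 ->
      exists p rm, many_room_machine p (pc p) (g rm).
    by move=> Ep [rm Erm] H; exists Y, rm; rewrite Ep Erm mY.
  (* L6 does not record how the rooms not yet in s0 split between s1 and s2, only that one
     exists. *)
  have stray : n0 < r -> exists2 rm, g rm != s0 & True.
    rewrite -N0 => lt; case: (posnP n1) => [z1|/f1 [rm Erm]]; last first.
      by exists rm; rewrite ?Erm ?s10.
    case: (posnP n2) => [z2|/f2 [rm Erm]]; last by exists rm; rewrite ?Erm ?s20.
    by lia.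
  case: L => [ex ey e0 e1 e2|ex ey e0 e1 e2|ex ey e0 e1 e2|ex ey e0 e1 e2|ex ey e0 e1 e2|ex ey e0].
  - by apply: (goX _ _ Ex (f2 _)); [num q|firew sE q pc].
  - by apply: (goX _ _ Ex (f1 _)); [num q|firew sE q pc].
  - case: (ltnP x (3 * r)) => x_r.
      by apply: (goX _ _ Ex (f2 _)); [num q|firew sE q pc].
    by apply: (goX _ _ Ex (f1 _)); [num q|firew sE q pc].
  (* All three states occur here, the single s2 having been left over on purpose, so the other
     worker can advance from any of the counters 0, 1, 2. *)
  - case: (posnP y) => y0; first by apply: (goY _ _ Ey (f1 _)); [num q|firew sE q pc].
    case: (eqVneq y 1) => y1; first by apply: (goY _ _ Ey (f2 _)); [num q|firew sE q pc].
    by apply: (goY _ _ Ey (f0 _)); [num q|firew sE q pc].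
  - case: (leqP x (3 * r + 1)) => x_r.
      by apply: (goX _ _ Ex (f1 _)); [num q|firew sE q pc].
    by apply: (goY _ _ Ey (f0 _)); [num q|firew sE q pc].
  - case: stray => [|rm /negbTE n_rm _]; first by num q.
    exists Y, rm; rewrite Ey mY /worker /rule n_rm.
    by split_ifs => //; exfalso; clear dependent q; clear dependent pc; lia.
have keep p rm : many_room_inv g pc (visit vis p rm).
  by apply: lateI; exists x, y, n0, n1, n2; split=> //; apply: confs_visit.
move=> p rm; have sees := nums_see s01 s02 s12 rm N.
have goX w k : [|| w == s0, w == s1 | w == s2] ->
  late k y (n0 - (g rm == s0) + (w == s0))
    (n1 - (g rm == s1) + (w == s1)) (n2 - (g rm == s2) + (w == s2)) ->
  (worker_lim y (g rm) -> worker_lim y w) ->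
  confined (upd g rm w) (visit vis X rm) X (lim X k) ->
  many_room_inv (upd g rm w) (upd pc X k) (visit vis X rm).
  move=> ws L' other own; apply: lateI; exists k, y; do 3!eexists; split;
    [|exact: (nums_move rm N ws)|exact: L'|].
    by case: neqX => *; split; rewrite ffunE ?eqxx // ifN.
  apply: confs_step C _ own => p'.
  by case: (ordXY p') => [->|->|->|[->|->]]; rewrite ?eqxx // => _;
    rewrite ?Ea ?Eb ?Ec ?Ey ?lY // /lim /=; split_ifs => //; exfalso; num q.
have goY w k : [|| w == s0, w == s1 | w == s2] ->
  late x k (n0 - (g rm == s0) + (w == s0))
    (n1 - (g rm == s1) + (w == s1)) (n2 - (g rm == s2) + (w == s2)) ->
  (worker_lim x (g rm) -> worker_lim x w) ->
  confined (upd g rm w) (visit vis Y rm) Y (lim Y k) ->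
  many_room_inv (upd g rm w) (upd pc Y k) (visit vis Y rm).
  move=> ws L' other own; apply: lateI; exists x, k; do 3!eexists; split;
    [|exact: (nums_move rm N ws)|exact: L'|].
    by case: neqY => *; split; rewrite ffunE ?eqxx // ifN.
  apply: confs_step C _ own => p'.
  by case: (ordXY p') => [->|->|->|[->|->]]; rewrite ?eqxx // => _;
    rewrite ?Ea ?Eb ?Ec ?Ex ?lX // /lim /=; split_ifs => //; exfalso; num q.
case: (ordXY p) => [->|->|->|[->|->]]; rewrite /step_ok.
- by rewrite /many_room_machine /= Ea; split_ifs; try exact: keep; exfalso; num q.
- by rewrite /many_room_machine /= Eb; split_ifs; try exact: keep; exfalso; num q.
- by rewrite /many_room_machine /= Ec; split_ifs; try exact: keep; exfalso; num q.
- rewrite mX Ex /worker /rule.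
  case: sees => -[Eg pos]; rewrite Eg !sE; split_ifs; try exact: keep; try (exfalso; lathe L q pc);
    by apply: goX; [by rewrite !sE|late_phase L Eg sE x r q pc|late_other L Eg sE q pc|
      late_own C N lX Ex L Eg sE q pc].
(* At the declaring move [rm] is the only room not in s0. The rooms missed by [Y] do not show s0, so
   none is left; for the others the limit set is already [pred0]. *)
have finish : [/\ (g rm == s0) = false, n0 = r - 1, x = 3 * r + 2
    & second <= y < second + r.-1] ->
    forall p' rm', rm' \in visit vis Y rm p'.
  case=> not0 e0 ex ey p' rm'.
  case: (eqVneq p' Y) => [->|p'Y]; last first.
    apply: (@confined_visited _ _ _ g); apply: confined_visit.
    move: p'Y (C p'); case: (ordXY p') => [->|->|->|[->|->]]; rewrite ?eqxx // => _;
      rewrite ?Ea ?Eb ?Ec ?Ex ?lX /lim /= /worker_lim; split_ifs => //; exfalso; num q.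
  have own : confined (upd g rm s0) (visit vis Y rm) Y (lim Y y).
    by rewrite -Ey; exact: confined_upd_self.
  apply: (@confined_visited _ _ _ (upd g rm s0)); have ws : [|| s0 == s0, s0 == s1 | s0 == s2].
    by rewrite eqxx.
  apply: (confined_nums s01 s02 s12 own (nums_move rm N ws)).
  rewrite lY /worker_lim; split_ifs; try (exfalso; num q).
  by case: sees => -[Eg ps]; move: not0; rewrite Eg ?sE //= => _;
    rewrite ?sE /= ?implybT ?andbT ?implybF; clear dependent q; lia.
rewrite mY Ey /worker /rule.
case: sees => -[Eg pos]; rewrite Eg !sE; split_ifs; try exact: keep; try (exfalso; lathe L q pc);
  try by apply: goY; [by rewrite !sE|late_phase L Eg sE x r q pc|late_other L Eg sE q pc|
      late_own C N lY Ey L Eg sE q pc].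
- apply: goY; [by rewrite !sE|late_phase L Eg sE x r q pc|late_other L Eg sE q pc|].
  (* [Y] overwrote one of the two s0 left by [X] with s1, so the s0 it meets now is the only one. *)
  refine (seen_alone _ N Eg _ _); first by rewrite N0; lathe L q pc.
  by rewrite lY /worker_lim; split; split_ifs; rewrite /= ?sE // => *; lathe L q pc.
- by apply: finish; split; [by rewrite Eg sE|lathe L q pc|lathe L q pc|lathe L q pc].
by apply: finish; split; [by rewrite Eg sE|lathe L q pc|lathe L q pc|lathe L q pc].
Qed.

Lemma many_room_live : live_invariant many_room_machine many_room_inv.
Proof.
move=> g pc vis [early|late|late]; first exact: early_live.
  by apply: late_live late; left.
by apply: late_live late; right.
Qed.

Lemma many_room_bounded : bounded_machine many_room_machine (second + r).
Proof.
move=> p k c k' w b; rewrite /many_room_machine /worker /rule.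
by case: (val p) => [|[|[|m]]]; split_ifs => //; case=> <- _ _; lia.
Qed.

Theorem many_room_winning (init : 'I_r -> 'I_q) :
  exists st : strategy 5 q, winning init st.
Proof.
apply: (@sync_winning _ _ _ s0 s2 many_room_machine init _ _ _ (second + r) many_room_inv).
- by lia.
- by rewrite s02.
- move=> p p0; case: (ord5P p) p0 => [->|->|->|[->|->]]; rewrite ?eqxx // => _;
    by rewrite /many_room_machine /= /worker /rule !sE.
- exact: many_room_bounded.
- exact: many_room_live.
move=> vis _; constructor 1; exists 0, 0, 0, 0, 0, 0, 0, r; split.
- by split; rewrite ffunE.
- exact: nums_const.
- by constructor 1; rewrite ?subn0.
move=> p i _; rewrite !ffunE /lim /worker_lim.
by case: (val p) => [|[|[|m]]] /=; rewrite ?eqxx.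
Qed.

End ManyRooms.

(** * Assembling the cases by number of rooms *)

Theorem mainTheorem5 (r q : nat) :
  3 <= q -> 1 <= r -> r <> 3 ->
  forall init : 'I_r -> 'I_q, exists st : strategy 5 q, winning init st.
Proof.
move=> q3 r1 r3 init.
pose s0 := Ordinal (ltn_trans (isT : 0 < 2) q3).
pose s1 := Ordinal (ltn_trans (isT : 1 < 2) q3).
pose s2 := Ordinal q3.
case: r r1 r3 init => [//|[|[|[//|r]]]] _ _ init.
- exact: (@one_room_winning 3 q s0 s2).
- exact: (@two_room_winning 3 q s0 s1 s2).
- exact: (@many_room_winning r.+4 q s0 s1 s2).
Qed.
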